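(* Let $G:\mathbb{R}^p\to\mathbb{R}^p$ be monotone and $L$-Lipschitz continuous, let $y_0\in\mathbb{R}^p$, and let $\beta_k\in(0,1)$, $\eta_k>0$, $\hat\eta_k>0$ ($k\ge0$) be given; fix also an arbitrary $\beta_{-1}\in(0,1]$. Let $\{(x_k,y_k,z_k)\}$ be generated, for $k\ge0$, starting from $z_0=x_0:=y_0$, by $$\begin{cases} x_{k+1}:=y_k-\gamma_k Gy_k,\\ z_{k+1}:=x_{k+1}+\theta_k(x_{k+1}-x_k)+\nu_k(z_k-x_{k+1}),\\ y_{k+1}:=z_{k+1}-\hat\eta_k Gz_{k+1}+\eta_k Gy_k,\end{cases}$$ where $\gamma_k:=\frac{\eta_k}{1-\beta_k}$, $\theta_k:=\frac{\beta_k(1-\beta_{k-1})}{\beta_{k-1}}$, and $\nu_k:=\frac{\beta_k}{\beta_{k-1}}$. Then $\{(y_k,z_k)\}$ is identical to the sequence generated from the same $y_0$ (with $z_0:=y_0$) by the extra-anchored gradient (EAG) scheme $$\begin{cases} z_{k+1}:=\beta_k y_0+(1-\beta_k)y_k-\eta_k Gy_k,\\ y_{k+1}:=\beta_k y_0+(1-\beta_k)y_k-\hat\eta_k Gz_{k+1},\end{cases}\qquad k\ge 0.$$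
   Context: $G$ is monotone if $\langle Gx-Gy,x-y\rangle\ge0$ for all $x,y$, and $L$-Lipschitz continuous if $\|Gx-Gy\|\le L\|x-y\|$ for all $x,y$. *)

(* Defs.v *)
From mathcomp Require Import all_boot all_order all_algebra.
From mathcomp Require Import reals.
Set Implicit Arguments.
Unset Strict Implicit.
Unset Printing Implicit Defensive.
Import Order.TTheory GRing.Theory Num.Theory.
Local Open Scope ring_scope.

Definition dot (R : realType) (p : nat) (u v : 'rV[R]_p) : R :=
  \sum_(i < p) u ord0 i * v ord0 i.

(* The norm that MathComp-Analysis puts on 'rV[R]_p is the sup norm, hence a
   separate Euclidean norm. *)
Definition enorm (R : realType) (p : nat) (u : 'rV[R]_p) : R :=
  Num.sqrt (dot u u).

Definition monotone_op (R : realType) (p : nat) (G : 'rV[R]_p -> 'rV[R]_p)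
    : Prop :=
  forall x y, 0 <= dot (G x - G y) (x - y).

Definition lipschitz_op (R : realType) (p : nat) (L : R)
    (G : 'rV[R]_p -> 'rV[R]_p) : Prop :=
  forall x y, enorm (G x - G y) <= L * enorm (x - y).

(* beta_{k-1}; the value beta_{-1}, which is not in the range of
   beta : nat -> R, is the separate argument betam1. *)
Definition beta_prev (R : realType) (betam1 : R) (beta : nat -> R) (k : nat)
    : R :=
  if k is k'.+1 then beta k' else betam1.

Definition gamma (R : realType) (beta eta : nat -> R) (k : nat) : R :=
  eta k / (1 - beta k).

Definition theta (R : realType) (betam1 : R) (beta : nat -> R) (k : nat) : R :=
  beta k * (1 - beta_prev betam1 beta k) / beta_prev betam1 beta k.

Definition nu (R : realType) (betam1 : R) (beta : nat -> R) (k : nat) : R :=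
  beta k / beta_prev betam1 beta k.

Definition nesterov_seq (R : realType) (p : nat) (G : 'rV[R]_p -> 'rV[R]_p)
    (betam1 : R) (beta eta etahat : nat -> R) (y0 : 'rV[R]_p)
    (x y z : nat -> 'rV[R]_p) : Prop :=
  [/\ x 0%N = y0, y 0%N = y0, z 0%N = y0 &
   forall k : nat,
   [/\ x k.+1 = y k - gamma beta eta k *: G (y k),
       z k.+1 = x k.+1 + theta betam1 beta k *: (x k.+1 - x k)
                + nu betam1 beta k *: (z k - x k.+1) &
       y k.+1 = z k.+1 - etahat k *: G (z k.+1) + eta k *: G (y k)]].

Definition eag_seq (R : realType) (p : nat) (G : 'rV[R]_p -> 'rV[R]_p)
    (beta eta etahat : nat -> R) (y0 : 'rV[R]_p)
    (y z : nat -> 'rV[R]_p) : Prop :=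
  [/\ y 0%N = y0, z 0%N = y0 &
   forall k : nat,
   z k.+1 = beta k *: y0 + (1 - beta k) *: y k - eta k *: G (y k) /\
   y k.+1 = beta k *: y0 + (1 - beta k) *: y k - etahat k *: G (z k.+1)].

(* Main.v *)
(** Eliminating [y] and [G] from the Nesterov-type scheme reveals the anchor:
    [z_k = beta_{k-1} y0 + (1 - beta_{k-1}) x_k] for all [k].  Since
    [(1 - beta_k) gamma_k = eta_k], substituting the formula for [x_{k+1}] in
    this identity gives the EAG recursion. *)
Require Import Defs.
From mathcomp Require Import all_boot all_order all_algebra.
From mathcomp Require Import reals.
Import Order.TTheory GRing.Theory Num.Theory.
Local Open Scope ring_scope.

(** Since [theta] is [(1 - b)] times [nu], the factor [a / b] comes out of both corrections; the old
    iterate [x] then cancels, leaving [b *: (u - x')]. *)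
Lemma extrapolation_anchor (F : fieldType) (V : lmodType F) (a b : F)
    (u x x' : V) : b != 0 ->
  x' + (a * (1 - b) / b) *: (x' - x)
     + (a / b) *: (b *: u + (1 - b) *: x - x') = a *: u + (1 - a) *: x'.
Proof.
move=> b0; rewrite mulrAC -(scalerA _ (1 - b)) -addrA -scalerDr.
have -> : (1 - b) *: (x' - x) + (b *: u + (1 - b) *: x - x') = b *: (u - x').
  rewrite scalerBr [b *: u + _ - x']addrAC addrACA addNr addr0.
  by rewrite scalerBl scale1r addrC addrA subrK -scalerBr.
by rewrite scalerA divfK // scalerBr scalerBl scale1r addrCA.
Qed.

Lemma nesterov_anchor {R : realType} {p : nat} {G : 'rV[R]_p -> 'rV[R]_p}
    {betam1 : R} {beta eta etahat : nat -> R} {y0 : 'rV[R]_p}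
    {x y z : nat -> 'rV[R]_p} :
  betam1 != 0 -> (forall k, beta k != 0) ->
  nesterov_seq G betam1 beta eta etahat y0 x y z ->
  forall k, z k = beta_prev betam1 beta k *: y0
                  + (1 - beta_prev betam1 beta k) *: x k.
Proof.
move=> betam1_neq0 beta_neq0 [x0 _ z0 xyzS].
(* At index 0 both iterates equal [y0], so the weights sum to 1 whatever [betam1] is. *)
elim=> [|k IHk]; first by rewrite x0 z0 -scalerDl addrC subrK scale1r.
have [_ -> _] := xyzS k.
(* The case split settles the nonzero divisor: [betam1] at 0, a value of [beta] afterwards. *)
by rewrite {}IHk extrapolation_anchor //; case: k.
Qed.

Theorem theorem4 (R : realType) (p : nat) (G : 'rV[R]_p -> 'rV[R]_p) (L : R)
    (G_mono : monotone_op G) (G_lip : lipschitz_op L G)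
    (y0 : 'rV[R]_p) (betam1 : R) (beta eta etahat : nat -> R)
    (betam1_bnd : 0 < betam1 <= 1)
    (beta_bnd : forall k : nat, 0 < beta k < 1)
    (eta_gt0 : forall k : nat, 0 < eta k)
    (etahat_gt0 : forall k : nat, 0 < etahat k)
    (x y z : nat -> 'rV[R]_p)
    (xyz_nesterov : nesterov_seq G betam1 beta eta etahat y0 x y z)
    (y' z' : nat -> 'rV[R]_p)
    (yz_eag : eag_seq G beta eta etahat y0 y' z') :
  forall k : nat, (y k, z k) = (y' k, z' k).
Proof.
have betam1_neq0 : betam1 != 0 by case/andP: betam1_bnd => /lt0r_neq0.
have beta_neq0 k : beta k != 0 by case/andP: (beta_bnd k) => /lt0r_neq0.
have anchor := nesterov_anchor betam1_neq0 beta_neq0 xyz_nesterov.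
case: xyz_nesterov yz_eag => [_ y00 z00 xyzS] [y'0 z'0 yzS'].
elim=> [|k [yk _]]; first by rewrite y00 z00 y'0 z'0.
have [xS _ yS] := xyzS k; have [zS' yS'] := yzS' k.
have beta_neq1 : 1 - beta k != 0.
  by rewrite subr_eq0 eq_sym lt_eqF //; case/andP: (beta_bnd k).
have zS : z k.+1 = z' k.+1.
  rewrite anchor xS zS' -yk /= scalerBr scalerA addrA.
  by rewrite /gamma mulrC divfK.
(* Only the [z' k.+1] outside [G] is expanded; its [- eta k *: G (y k)] cancels the correction in
   [yS]. *)
by rewrite yS yS' zS {1}zS' -yk addrAC subrK.
Qed.
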